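(* Consider encodings $x_i\mapsto|\phi_i\rangle$, $i=1,2,3,4$, of the values of a four-dimensional random variable into pure qubit states (unit vectors in $\mathbb{C}^2$), and the following problem: maximize $\epsilon>0$ subject to $$1-|\langle\phi_i|\phi_{i'}\rangle|\geq\epsilon\quad\text{for all } i,i'\in\{1,2,3,4\},\ i\neq i',$$ and $$|\langle\phi_k|\phi_l\rangle|+|\langle\phi_l|\phi_m\rangle|+|\langle\phi_m|\phi_k\rangle|=|a|+|b|\quad\text{for all pairwise distinct } k,l,m\in\{1,2,3,4\},$$ where $a,b\in\mathbb{C}$ with $|a|^2+|b|^2=1$ are the same for all triples $(k,l,m)$. Then, for $\epsilon$ to attain its maximum in this problem, it is necessary and sufficient that the values are encoded in the states of mutually unbiased bases, i.e. that the four states $|\phi_1\rangle,\dots,|\phi_4\rangle$ can be partitioned into two pairs, each an orthonormal basis of $\mathbb{C}^2$, the two bases being mutually unbiased.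
   Context: Two orthonormal bases $\{|\nu_1\rangle,\dots,|\nu_D\rangle\}$ and $\{|\nu_1'\rangle,\dots,|\nu_D'\rangle\}$ of a $D$-dimensional Hilbert space are mutually unbiased if and only if $|\langle\nu_i|\nu'_{i'}\rangle|=1/\sqrt{D}$ for all $i,i'$; here $D=2$. The numbers $a,b$ are not fixed in advance: the maximization is over all encodings $(|\phi_i\rangle)_{i=1}^4$, all $\epsilon>0$, and all $a,b\in\mathbb{C}$ with $|a|^2+|b|^2=1$ satisfying the constraints. *)

(* Defs.v *)
From mathcomp Require Import all_boot all_order all_fingroup all_algebra.
From mathcomp Require Import reals complex.

Set Implicit Arguments.
Unset Strict Implicit.
Unset Printing Implicit Defensive.

Import Order.TTheory GRing.Theory Num.Theory.
Local Open Scope ring_scope.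
Local Open Scope complex_scope.

Section States.
Variables (R : realType) (D : nat).
Implicit Types (u : 'rV[R[i]]_D) (v w : 'I_D -> 'rV[R[i]]_D).

(* Vectors of C^D are row vectors, as in spectral.v. [dotmx] is conjugate-linear
   in its second argument, whereas <u|v> is conjugate-linear in the first. *)
Definition braket (u1 u2 : 'rV[R[i]]_D) : R[i] := dotmx u2 u1.

Definition pure_state u : Prop := braket u u = 1.

Definition orthonormal_basis v : Prop :=
  basis_of fullv [seq v i | i <- enum 'I_D] /\
  (forall i j, braket (v i) (v j) = (i == j)%:R).

Definition mutually_unbiased v w : Prop :=
  forall i j, `|braket (v i) (w j)| = (sqrtC D%:R)^-1.

End States.

Section Encodings.
Variable R : realType.

(* The order on R[i] is the partial one: x <= y holds iff x and y have equal
   imaginary parts and Re x <= Re y; both sides below are real. *)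
Definition feasible (phi : 'I_4 -> 'rV[R[i]]_2) (eps : R) (a b : R[i]) : Prop :=
  [/\ forall i, pure_state (phi i),
      0 < eps,
      `|a| ^+ 2 + `|b| ^+ 2 = 1,
      forall i j, i != j -> eps%:C <= 1 - `|braket (phi i) (phi j)|
    & forall k l m, k != l -> l != m -> m != k ->
        `|braket (phi k) (phi l)| + `|braket (phi l) (phi m)|
          + `|braket (phi m) (phi k)| = `|a| + `|b| ].

(* [phi] is the encoding of an optimal solution [(phi, eps, a, b)]; the
   competing solutions have their own encoding and their own [a'], [b']. *)
Definition attains_maximum (phi : 'I_4 -> 'rV[R[i]]_2) : Prop :=
  exists eps a b, feasible phi eps a b /\
    forall phi' eps' a' b', feasible phi' eps' a' b' -> eps' <= eps.

(* The permutation [s] gives the partition of the four states into the pairs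
   s 0, s 1 and s 2, s 3 (as 'I_4 is 'I_(2 + 2)). *)
Definition in_mutually_unbiased_bases (phi : 'I_4 -> 'rV[R[i]]_2) : Prop :=
  exists s : 'S_4,
    let v (i : 'I_2) := phi (s (lshift 2 i)) in
    let w (i : 'I_2) := phi (s (rshift 2 i)) in
    [/\ orthonormal_basis v, orthonormal_basis w & mutually_unbiased v w].

End Encodings.

(* Main.v *)
(** Write [x_ij] for the overlap of the states [i] and [j].  Equality of the four
    triangle sums forces opposite overlaps to agree ([x_12 = x_34], and so on), so
    only three numbers [x, y, z] remain, with [x + y + z = |a| + |b| <= sqrt 2].
    The sum of the four Bloch vectors has nonnegative squared length, which says
    [x^2 + y^2 + z^2 >= 1] (a Welch bound).  If [m] is the largest overlap, then
    [1 <= x^2 + y^2 + z^2 <= m (x + y + z) <= m sqrt 2], so [m >= 1 / sqrt 2], and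
    equality forces each of [x, y, z] to be [0] or [m], with exactly one zero:
    two orthogonal pairs, mutually unbiased. *)

Require Import Defs.
From mathcomp Require Import all_boot all_order all_fingroup all_algebra.
From mathcomp Require Import reals complex.
From mathcomp Require Import sesquilinear spectral ring lra zify.

Import Order.TTheory GRing.Theory Num.Theory.
Local Open Scope ring_scope.
Local Open Scope complex_scope.

(** * Overlaps, Bloch vectors and the Welch bound *)

Section Overlaps.
Context {R : realType}.

(** The norm on [R[i]] takes its values in [R[i]]; passing to [R] gives access to a total order and
    to [lra] and [nra]. *)
Definition overlap {D : nat} (u v : 'rV[R[i]]_D) : R := complex.Re `|braket u v|.

Lemma overlapE {D : nat} (u v : 'rV[R[i]]_D) : `|braket u v| = (overlap u v)%:C.
Proof. by rewrite /overlap normc_def. Qed.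

Lemma braket_sum {D : nat} (u v : 'rV[R[i]]_D) :
  braket u v = \sum_j v 0 j * (u 0 j)^*.
Proof.
rewrite /braket dotmxE !mxE; apply: eq_bigr => j _; by rewrite !mxE.
Qed.

Lemma braketC {D : nat} (u v : 'rV[R[i]]_D) : braket u v = (braket v u)^*.
Proof.
rewrite !braket_sum rmorph_sum; apply: eq_bigr => j _.
by rewrite rmorphM /= conjcK mulrC.
Qed.

Lemma overlap_ge0 {D : nat} (u v : 'rV[R[i]]_D) : 0 <= overlap u v.
Proof. by rewrite -ler0c -overlapE normr_ge0. Qed.

Lemma overlapC {D : nat} (u v : 'rV[R[i]]_D) : overlap u v = overlap v u.
Proof. by rewrite /overlap braketC normcJ. Qed.

Lemma overlap_pure {D : nat} (u : 'rV[R[i]]_D) : pure_state u -> overlap u u = 1.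
Proof. by rewrite /pure_state /overlap => ->; rewrite normr1. Qed.

Lemma overlap_sqr {D : nat} (u v : 'rV[R[i]]_D) :
  overlap u v ^+ 2 = complex.Re (braket u v) ^+ 2 + complex.Im (braket u v) ^+ 2.
Proof. by apply: complexI; rewrite rmorphXn /= -overlapE add_Re2_Im2. Qed.

Lemma qubit_braket (u v : 'rV[R[i]]_2) :
  braket u v = v 0 0 * (u 0 0)^* + v 0 1 * (u 0 1)^*.
Proof.
rewrite braket_sum !big_ord_recl big_ord0 addr0.
by have -> : lift ord0 ord0 = 1 :> 'I_2 by apply: val_inj.
Qed.

(** With [bloch_y] and [bloch_z], the Bloch vector: the expectations of the three Pauli matrices. *)
Definition bloch_x (u : 'rV[R[i]]_2) : R := complex.Re (2 * (u 0 0)^* * u 0 1).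
Definition bloch_y (u : 'rV[R[i]]_2) : R := complex.Im (2 * (u 0 0)^* * u 0 1).
Definition bloch_z (u : 'rV[R[i]]_2) : R :=
  complex.Re (u 0 0 * (u 0 0)^* - u 0 1 * (u 0 1)^*).

Lemma qubit_overlap_bloch {u v : 'rV[R[i]]_2} :
  pure_state u -> pure_state v ->
  2 * overlap u v ^+ 2 =
    1 + (bloch_x u * bloch_x v + bloch_y u * bloch_y v + bloch_z u * bloch_z v).
Proof.
rewrite /pure_state overlap_sqr !qubit_braket /bloch_x /bloch_y /bloch_z.
case: (u 0 0) (u 0 1) (v 0 0) (v 0 1) => [a b] [c d] [e f] [g h].
case=> + _ [+ _] /=.
set N := (X in X = 1 -> _) => Nu; set M := (X in X = 1 -> _) => Mv.
set B := (X in _ = 1 + X).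
(* Writing 1 as the product of the two squared norms makes this a polynomial identity in eight real
   coordinates. *)
transitivity (N * M + B); last by rewrite Nu Mv mulr1.
by rewrite /N /M /B; ring.
Qed.

(** Summing the Bloch formula over all ordered pairs, diagonal included, leaves the squared length
    of the total Bloch vector as the excess. *)
Lemma qubit_welch (I : finType) (phi : I -> 'rV[R[i]]_2) :
  (forall i, pure_state (phi i)) ->
  (#|I| ^ 2)%:R <= 2 * \sum_i \sum_j overlap (phi i) (phi j) ^+ 2.
Proof.
move=> pure; pose sq (f : 'rV[R[i]]_2 -> R) := (\sum_i f (phi i)) ^+ 2.
have sqE f : \sum_i \sum_j f (phi i) * f (phi j) = sq f.
  by rewrite /sq expr2 mulr_suml; apply: eq_bigr => i _; rewrite mulr_sumr.
suff -> : 2 * \sum_i \sum_j overlap (phi i) (phi j) ^+ 2 =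
    (#|I| ^ 2)%:R + (sq bloch_x + sq bloch_y + sq bloch_z).
  by rewrite lerDl !addr_ge0 ?sqr_ge0.
have cardE : (#|I| ^ 2)%:R = \sum_(i : I) \sum_(j : I) 1 :> R.
  by rewrite !sumr_const -mulrnA mulnn.
rewrite cardE -!sqE -!big_split mulr_sumr; apply: eq_bigr => i _ /=.
rewrite -!big_split mulr_sumr; apply: eq_bigr => j _ /=.
by rewrite (qubit_overlap_bloch (pure i) (pure j)).
Qed.

End Overlaps.

(** * The optimal value and the overlap pattern of optimal encodings *)

Section Optimum.
Context {R : realType}.
Implicit Type phi : 'I_4 -> 'rV[R[i]]_2.

Local Notation s2 := ((Num.sqrt 2)^-1 : R).

Lemma s2_gt0 : 0 < s2.
Proof. by rewrite invr_gt0 sqrtr_gt0 ltr0n. Qed.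

Lemma s2_sqr : s2 ^+ 2 = 1 / 2.
Proof. by rewrite exprVn sqr_sqrtr ?ler0n // div1r. Qed.

Lemma sqrtC2 : (sqrtC 2%:R)^-1 = s2%:C :> R[i].
Proof.
have -> : 2%:R = (Num.sqrt 2 : R)%:C ^+ 2 :> R[i].
  by rewrite -rmorphXn /= sqr_sqrtr ?ler0n // rmorph_nat.
by rewrite sqrCK ?ler0c ?sqrtr_ge0 // fmorphV.
Qed.

(** Here and in the next two lemmas [s] stands for 1 / sqrt 2, known only through its sign and
    square, so that [nra] meets polynomials alone. *)
Lemma sum_le_of_sumsq1 (s a b : R) : 0 < s -> s ^+ 2 = 1 / 2 ->
  a ^+ 2 + b ^+ 2 = 1 -> a + b <= 2 * s.
Proof. by move=> s0 ss ab; have := sqr_ge0 (a - b); nra. Qed.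

Lemma triple_max_ge (s m x y z : R) : 0 < s -> s ^+ 2 = 1 / 2 ->
  0 <= x <= m -> 0 <= y <= m -> 0 <= z <= m ->
  x + y + z <= 2 * s -> 1 <= x ^+ 2 + y ^+ 2 + z ^+ 2 -> s <= m.
Proof.
move=> s0 ss /andP[x0 xm] /andP[y0 ym] /andP[z0 zm] S Q.
have hx : x ^+ 2 <= m * x by rewrite expr2 ler_wpM2r.
have hy : y ^+ 2 <= m * y by rewrite expr2 ler_wpM2r.
have hz : z ^+ 2 <= m * z by rewrite expr2 ler_wpM2r.
have hm : m * (x + y + z) <= m * (2 * s).
  by apply: ler_wpM2l => //; apply: le_trans xm.
(* The bounds chain to [1 <= m * (2 * s)], while [2 * s * s = 1]. *)
have : s * s <= m * s by nra.
by rewrite ler_pM2r.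
Qed.

(** Since [s * (x + y + z) <= 1], the nonnegative terms [x * (s - x)], [y * (s - y)], [z * (s - z)]
    have sum at most 0, so each vanishes. *)
Lemma triple_max_eq (s x y z : R) : 0 < s -> s ^+ 2 = 1 / 2 ->
  0 <= x <= s -> 0 <= y <= s -> 0 <= z <= s ->
  x + y + z <= 2 * s -> 1 <= x ^+ 2 + y ^+ 2 + z ^+ 2 ->
  [\/ [/\ x = 0, y = s & z = s], [/\ x = s, y = 0 & z = s]
    | [/\ x = s, y = s & z = 0]].
Proof.
move=> s0 ss /andP[x0 xm] /andP[y0 ym] /andP[z0 zm] S Q.
have hS : s * (x + y + z) <= 1 by nra.
have hx : 0 <= x * (s - x) by rewrite mulr_ge0 ?subr_ge0.
have hy : 0 <= y * (s - y) by rewrite mulr_ge0 ?subr_ge0.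
have hz : 0 <= z * (s - z) by rewrite mulr_ge0 ?subr_ge0.
have or_eq t : t * (s - t) = 0 -> t = 0 \/ t = s.
  by move/eqP; rewrite mulf_eq0 subr_eq0 => /orP[] /eqP ->; [left | right].
have /or_eq ex : x * (s - x) = 0 by nra.
have /or_eq ey : y * (s - y) = 0 by nra.
have /or_eq ez : z * (s - z) = 0 by nra.
move: S Q; case: ex => ->; case: ey => ->; case: ez => -> S Q.
all: try by [constructor 1 | constructor 2 | constructor 3].
(* No zero violates the bound on the sum; two or more zeros violate the bound on the squares. *)
all: exfalso; nra.
Qed.

Definition unbiased_pairs phi : Prop :=
  forall i j, i != j ->
    overlap (phi i) (phi j) = if (i < 2)%N == (j < 2)%N then 0 else s2.

Lemma feasibleP phi eps a b : feasible phi eps a b <->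
  [/\ forall i, pure_state (phi i), 0 < eps,
      complex.Re `|a| ^+ 2 + complex.Re `|b| ^+ 2 = 1,
      forall i j, i != j -> overlap (phi i) (phi j) <= 1 - eps
    & forall k l m, k != l -> l != m -> m != k ->
        overlap (phi k) (phi l) + overlap (phi l) (phi m) + overlap (phi m) (phi k)
          = complex.Re `|a| + complex.Re `|b| ].
Proof.
have normE (z : R[i]) : exists r : R, `|z| = r%:C by eexists; rewrite normc_def.
have sub1E (u v : 'rV[R[i]]_2) : 1 - `|braket u v| = (1 - overlap u v)%:C.
  by rewrite overlapE rmorphB rmorph1.
have sum3E (u v w : R[i]) (x y z c d : R) : u = x%:C -> v = y%:C -> w = z%:C ->
    u + v + w = c%:C + d%:C <-> x + y + z = c + d.
  by move=> -> -> ->; rewrite -!(rmorphD (real_complex R)); split=> [/complexI|->].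
rewrite /feasible; have [[A ->] [B ->]] := (normE a, normE b); rewrite /=.
split=> -[pure eps0 ab le_eps tri]; split=> //.
- by apply: complexI; rewrite rmorphD !rmorphXn.
- by move=> i j /le_eps; rewrite sub1E lecR !lerBrDr addrC.
- move=> k l m kl lm mk; move: (tri k l m kl lm mk).
  exact: (sum3E _ _ _ _ _ _ _ _ (overlapE _ _) (overlapE _ _) (overlapE _ _)).1.
- by rewrite -!rmorphXn -(rmorphD (real_complex R)) ab.
- by move=> i j /le_eps; rewrite sub1E lecR !lerBrDr addrC.
- move=> k l m kl lm mk; move: (tri k l m kl lm mk).
  exact: (sum3E _ _ _ _ _ _ _ _ (overlapE _ _) (overlapE _ _) (overlapE _ _)).2.
Qed.

(** Three of the four states always include exactly one orthogonal pair, so each triangle sum is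
    [2 * s2], which [a = b = s2] matches. *)
Lemma unbiased_pairs_feasible phi (p : 'S_4) :
  (forall i, pure_state (phi i)) -> unbiased_pairs (phi \o p) ->
  feasible phi (1 - s2) s2%:C s2%:C.
Proof.
have s0 := s2_gt0; have ss := s2_sqr.
move=> pure unb; apply/feasibleP.
have -> : complex.Re `|s2%:C| = s2 by rewrite ger0_norm ?ler0c ?ltW.
have ov i j : i != j -> overlap (phi i) (phi j) =
    if ((p^-1)%g i < 2)%N == ((p^-1)%g j < 2)%N then 0 else s2.
  move=> ij; have := unb ((p^-1)%g i) ((p^-1)%g j).
  by rewrite (inj_eq perm_inj) ![(_ \o _) _]/= !permKV => /(_ ij).
split=> //.
- by nra.
- by rewrite ss; lra.
- by move=> i j /ov ->; case: ifP => _; lra.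
- move=> k l m kl lm mk; rewrite !ov //.
  have : [&& (p^-1)%g k != (p^-1)%g l, (p^-1)%g l != (p^-1)%g m
    & (p^-1)%g m != (p^-1)%g k].
    by rewrite !(inj_eq perm_inj) kl lm mk.
  move: ((p^-1)%g k) ((p^-1)%g l) ((p^-1)%g m) => [x xlt] [y ylt] [z zlt].
  rewrite -!(inj_eq val_inj) /= => /and3P[xy yz zx].
  case: ltnP => hx; case: ltnP => hy; case: ltnP => hz /=; try lra.
  (* What remains is three distinct indices in one half of ['I_4]. *)
  all: exfalso; lia.
Qed.

Lemma sum_I4 (f : 'I_4 -> R) : \sum_i f i = f 0 + f 1 + f 2 + f 3.
Proof.
rewrite !big_ord_recl big_ord0 addr0 !addrA.
by congr (_ + f _ + f _ + f _); apply: val_inj.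
Qed.

Lemma forall_I4 (P : 'I_4 -> Prop) : P 0 -> P 1 -> P 2 -> P 3 -> forall i, P i.
Proof.
move=> P0 P1 P2 P3 [[|[|[|[|//]]]] lt_i4].
- by rewrite (_ : Ordinal _ = 0) //; apply: val_inj.
- by rewrite (_ : Ordinal _ = 1) //; apply: val_inj.
- by rewrite (_ : Ordinal _ = 2) //; apply: val_inj.
- by rewrite (_ : Ordinal _ = 3) //; apply: val_inj.
Qed.

(** The two triangles on edge 01 and the two on edge 23 share their other four edges, so equal sums
    force [G 0 1 = G 2 3]; likewise for the other opposite edges. *)
Lemma equal_triangles (G : 'I_4 -> 'I_4 -> R) (c : R) :
  (forall i, G i i = 1) -> (forall i j, G i j = G j i) ->
  (forall k l m, k != l -> l != m -> m != k -> G k l + G l m + G m k = c) ->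
  exists x y z : R,
  [/\ [/\ G 0 1 = x, G 0 2 = y & G 0 3 = z],
      [/\ G 2 3 = x, G 1 3 = y & G 1 2 = z], c = x + y + z
    & \sum_i \sum_j G i j ^+ 2 = 4 * (1 + x ^+ 2 + y ^+ 2 + z ^+ 2)].
Proof.
move=> G1 GC tri.
have := tri 0 1 2 isT isT isT; have := tri 0 1 3 isT isT isT.
have := tri 0 2 3 isT isT isT; have := tri 1 2 3 isT isT isT.
rewrite !sum_I4 !G1 (GC 1 0) (GC 2 0) (GC 3 0) (GC 2 1) (GC 3 1) (GC 3 2).
move: (G 0 1) (G 0 2) (G 0 3) (G 1 2) (G 1 3) (G 2 3) => x y z z' y' x'.
move=> t123 t023 t013 t012.
have -> : x' = x by lra.
have -> : y' = y by lra.
have -> : z' = z by lra.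
by exists x, y, z; split=> //; [lra | ring].
Qed.

Lemma feasible_overlaps phi eps a b : feasible phi eps a b ->
  exists x y z : R,
  [/\ [/\ overlap (phi 0) (phi 1) = x, overlap (phi 0) (phi 2) = y
        & overlap (phi 0) (phi 3) = z],
      [/\ overlap (phi 2) (phi 3) = x, overlap (phi 1) (phi 3) = y
        & overlap (phi 1) (phi 2) = z],
      [/\ 0 <= x <= 1 - eps, 0 <= y <= 1 - eps & 0 <= z <= 1 - eps],
      x + y + z <= 2 * s2 & 1 <= x ^+ 2 + y ^+ 2 + z ^+ 2].
Proof.
move=> /feasibleP[pure _ ab le_eps tri].
have le_c := sum_le_of_sumsq1 _ _ _ s2_gt0 s2_sqr ab.
have welch := qubit_welch _ _ pure; rewrite card_ord in welch.
have bnd i j : i != j -> 0 <= overlap (phi i) (phi j) <= 1 - eps.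
  by move=> ij; rewrite overlap_ge0 le_eps.
have ov1 i := overlap_pure _ (pure i).
have ovC i j := overlapC (phi i) (phi j).
have [x [y [z [e0 e1 cE sumE]]]] :=
  equal_triangles (fun i j => overlap (phi i) (phi j)) _ ov1 ovC tri.
exists x, y, z; split; [exact: e0 | exact: e1 | | |].
- case: e0 => <- <- <-.
  exact: (And3 (bnd 0 1 isT) (bnd 0 2 isT) (bnd 0 3 isT)).
- by move: le_c; rewrite cE.
(* The Welch bound reads [16 <= 8 * (1 + x ^+ 2 + y ^+ 2 + z ^+ 2)]. *)
- by move: sumE welch => -> ; lra.
Qed.

Lemma feasible_le phi eps a b : feasible phi eps a b -> eps <= 1 - s2.
Proof.
case/feasible_overlaps=> x [y [z [_ _ [xm ym zm] S Q]]].
have := triple_max_ge _ _ _ _ _ s2_gt0 s2_sqr xm ym zm S Q; lra.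
Qed.

Lemma unbiased_pairs_entries (G : 'I_4 -> 'I_4 -> R) (t : R) :
  (forall i j, G i j = G j i) ->
  G 0 1 = 0 -> G 2 3 = 0 ->
  G 0 2 = t -> G 0 3 = t -> G 1 2 = t -> G 1 3 = t ->
  forall i j, i != j -> G i j = if (i < 2)%N == (j < 2)%N then 0 else t.
Proof.
move=> GC e01 e23 e02 e03 e12 e13.
have lt_G (i j : 'I_4) : (i < j)%N -> G i j = if (i < 2)%N == (j < 2)%N then 0 else t.
  by move: i j; apply: forall_I4; apply: forall_I4.
move=> i j; rewrite -(inj_eq val_inj) neq_ltn => /orP[/lt_G // | /lt_G].
by rewrite GC eq_sym.
Qed.

Lemma unbiased_pairsI phi (p : 'S_4) (i0 i1 i2 i3 : 'I_4) :
  p 0 = i0 -> p 1 = i1 -> p 2 = i2 -> p 3 = i3 ->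
  overlap (phi i0) (phi i1) = 0 -> overlap (phi i2) (phi i3) = 0 ->
  overlap (phi i0) (phi i2) = s2 -> overlap (phi i0) (phi i3) = s2 ->
  overlap (phi i1) (phi i2) = s2 -> overlap (phi i1) (phi i3) = s2 ->
  unbiased_pairs (phi \o p).
Proof.
move=> <- <- <- <-.
apply: (unbiased_pairs_entries (fun i j => overlap (phi (p i)) (phi (p j)))) => i j.
exact: overlapC.
Qed.

Lemma feasible_optimal phi eps a b : feasible phi eps a b -> eps = 1 - s2 ->
  exists p : 'S_4, unbiased_pairs (phi \o p).
Proof.
case/feasible_overlaps=> x [y [z [[e01 e02 e03] [e23 e13 e12] bounds S Q]]] eps_max.
have eps_s2 : 1 - eps = s2 by rewrite eps_max subKr.
move: bounds; rewrite eps_s2 => -[xm ym zm].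
(* The vanishing overlap dictates the pairing, 01|23, 02|13 or 03|12, and the permutation lists the
   indices pair by pair. *)
case: (triple_max_eq _ _ _ _ s2_gt0 s2_sqr xm ym zm S Q) => -[ex ey ez];
  rewrite {}ex {}ey {}ez in e01 e02 e03 e23 e13 e12.
- exists 1%g.
  exact: (unbiased_pairsI _ _ _ _ _ _ (perm1 _) (perm1 _) (perm1 _) (perm1 _)
            e01 e23 e02 e03 e12 e13).
- have [p0 p3] : tperm 1 2 0 = 0 :> 'I_4 /\ tperm 1 2 3 = 3 :> 'I_4.
    by rewrite !tpermD.
  exists (tperm 1 2).
  exact: (unbiased_pairsI _ _ _ _ _ _ p0 (tpermL _ _) (tpermR _ _) p3
            e02 e13 e01 e03 (etrans (overlapC _ _) e12) e23).
- have [p0 p2] : tperm 1 3 0 = 0 :> 'I_4 /\ tperm 1 3 2 = 2 :> 'I_4.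
    by rewrite !tpermD.
  exists (tperm 1 3).
  exact: (unbiased_pairsI _ _ _ _ _ _ p0 (tpermL _ _) p2 (tpermR _ _)
            e03 (etrans (overlapC _ _) e12) e02 e01
            (etrans (overlapC _ _) e23) (etrans (overlapC _ _) e13)).
Qed.

End Optimum.

(** * From overlap patterns to mutually unbiased bases *)

Lemma orthonormal_basisP {R : realType} {D : nat} (v : 'I_D -> 'rV[R[i]]_D) :
  orthonormal_basis v <-> forall i j, braket (v i) (v j) = (i == j)%:R.
Proof.
split=> [[]//|orth]; split=> //.
rewrite basisEfree subvf dimvf dim_matrix mul1r size_map size_enum_ord leqnn !andbT.
have -> : [seq v i | i <- enum 'I_D] = [tuple v i | i < D] by [].
apply/freeP => k sum0 i.
(* Pairing with [v i] reads off the coefficient [k i], so orthonormal vectors are free; [D] of them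
   then span. *)
have : braket (v i) (\sum_j k j *: v j) = k i.
  rewrite /braket linear_sumlz (bigD1 i) //= linearZl_LR /=.
  rewrite -/(braket _ _) orth eqxx mulr1 big1 ?addr0 // => j neq_ji.
  by rewrite linearZl_LR /= -/(braket _ _) orth eq_sym (negbTE neq_ji) mulr0.
rewrite (_ : \sum_j _ = 0) => [<-|]; first by rewrite /braket linear0l.
by rewrite -[RHS]sum0; apply: eq_bigr => j _; rewrite -tnth_nth tnth_mktuple.
Qed.

Lemma in_mutually_unbiased_basesP {R : realType} {phi : 'I_4 -> 'rV[R[i]]_2} :
  (forall i, pure_state (phi i)) ->
  in_mutually_unbiased_bases phi <-> exists p : 'S_4, unbiased_pairs (phi \o p).
Proof.
move=> pure.
have ov0 (u v : 'rV[R[i]]_2) : overlap u v = 0 <-> braket u v = 0.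
  split=> [ov|br]; last by rewrite /overlap br normr0.
  by apply/eqP; rewrite -normr_eq0 overlapE ov.
have ltl (a : 'I_2) : ((lshift 2 a : 'I_4) < 2)%N = true by case: a.
have ltr (a : 'I_2) : ((rshift 2 a : 'I_4) < 2)%N = false.
  by apply/negbTE; rewrite -leqNgt leq_addr.
have halves (i : 'I_4) : exists a : 'I_2, i = lshift 2 a \/ i = rshift 2 a.
  by case: (@split_ordP 2 2 i) => a ->; exists a; [left | right].
have eql (a b : 'I_2) : (lshift 2 a == lshift 2 b :> 'I_4) = (a == b).
  exact: (inj_eq (@lshift_inj 2 2)).
have eqr (a b : 'I_2) : (rshift 2 a == rshift 2 b :> 'I_4) = (a == b).
  exact: (inj_eq (@rshift_inj 2 2)).
have neq_lr (a b : 'I_2) : (lshift 2 a != rshift 2 b :> 'I_4).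
  by rewrite (@eq_lrshift 2 2).
split=> [[s [/orthonormal_basisP orth_v /orthonormal_basisP orth_w mu]]|[p unb]].
- have ov_vw (i j : 'I_2) :
      overlap (phi (s (lshift 2 i))) (phi (s (rshift 2 j))) = (Num.sqrt 2)^-1.
    by apply: complexI; rewrite -overlapE mu sqrtC2.
  exists s; move=> i j; have [a [->|->]] := halves i; have [b [->|->]] := halves j.
  + move=> ab; rewrite !ltl eqxx; apply/ov0.
    by rewrite orth_v; move: ab; rewrite eql => /negbTE ->.
  + by move=> _; rewrite ltl ltr ov_vw.
  + by move=> _; rewrite ltl ltr overlapC ov_vw.
  + move=> ab; rewrite !ltr eqxx; apply/ov0.
    by rewrite orth_w; move: ab; rewrite eqr => /negbTE ->.
- exists p; split.
  + apply/orthonormal_basisP => i j; case: eqVneq => [->|ij]; first exact: pure.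
    by apply/ov0; rewrite unb ?eql // !ltl.
  + apply/orthonormal_basisP => i j; case: eqVneq => [->|ij]; first exact: pure.
    by apply/ov0; rewrite unb ?eqr // !ltr.
  + by move=> i j; rewrite overlapE sqrtC2 unb ?neq_lr // ltl ltr.
Qed.

(** * An explicit optimum and the equivalence *)

Lemma unbiased_pairs_exist (R : realType) :
  exists2 phi : 'I_4 -> 'rV[R[i]]_2,
    forall i, pure_state (phi i) & unbiased_pairs (phi \o (1%g : 'S_4)).
Proof.
pose r (a b : R) : 'rV[R[i]]_2 := \row_j (if j == 0 then a else b)%:C.
have r_braket a b c d : braket (r a b) (r c d) = (a * c + b * d)%:C.
  have conjR (x : R) : Num.conj x%:C = x%:C by apply: conjc_real.
  rewrite qubit_braket !mxE !conjR -!rmorphM -(rmorphD (real_complex R)).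
  by rewrite mulrC [d * b]mulrC.
have r_overlap a b c d : overlap (r a b) (r c d) = `|a * c + b * d|.
  by rewrite /overlap r_braket normc_def /= expr0n addr0 sqrtr_sqr.
have s0 := @s2_gt0 R; have ss := @s2_sqr R; set s := (Num.sqrt 2)^-1 in s0 ss.
have r_pure a b : a * a + b * b = 1 -> pure_state (r a b).
  by move=> ab; rewrite /pure_state r_braket ab.
(* The eigenbases of the Pauli matrices Z and X. *)
exists (fun i => nth 0 [:: r 1 0; r 0 1; r s s; r s (- s)] i).
- by apply: forall_I4; apply: r_pure; lra.
apply: (unbiased_pairsI _ _ _ _ _ _ (perm1 _) (perm1 _) (perm1 _) (perm1 _));
  by rewrite r_overlap ?(mul0r, mul1r, mulr0, add0r, addr0, mulrN, subrr, normr0,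
    normrN) // gtr0_norm.
Qed.

Theorem proposition5 (R : realType) (phi : 'I_4 -> 'rV[R[i]]_2)
    (phi_pure : forall i, pure_state (phi i)) :
  attains_maximum phi <-> in_mutually_unbiased_bases phi.
Proof.
apply: iff_trans (iff_sym (in_mutually_unbiased_basesP phi_pure)).
split=> [[eps [a [b [feas eps_max]]]]|[p unb]].
  (* The general bound gives [eps] at most 1 - 1 / sqrt 2; competition with the explicit encoding
     gives the reverse. *)
  apply: (feasible_optimal _ _ _ _ feas); apply/eqP.
  rewrite eq_le (feasible_le _ _ _ _ feas).
  have [phi0 pure0 unb0] := unbiased_pairs_exist R.
  exact: eps_max (unbiased_pairs_feasible _ _ pure0 unb0).
do 3!eexists; split; first exact: unbiased_pairs_feasible phi_pure unb.
by move=> phi' eps' a' b'; apply: feasible_le.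
Qed.
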